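(* Let $q\ge1$ and $N\in\mathbb{N}$, and suppose that for every $\omega\in\Omega$ the distributions of the frequency responses of the systems $P_1$ and $P_2$ are the empirical distributions $$\mathbb{P}_{P_\ell(\omega)}=\frac1N\sum_{i=1}^N\boldsymbol{\delta}_{\hat P_\ell^{(i)}(j\omega)},\qquad \ell=1,2,$$ built from samples $\hat P^{(i)}_\ell(j\omega)\in\mathbb{C}$, $i=1,\dots,N$, where $\boldsymbol{\delta}_c$ is the Dirac measure at $c$. Then $$\mathrm{d}_q(P_1,P_2)=\sup_{\omega\in\Omega}\ \inf_{\pi_\omega\in\Pi_\omega}\ \sum_{i=1}^N\sum_{k=1}^N\mathrm{d_{chord}}\left(\hat R_1^{(i)}(j\omega),\hat R_2^{(k)}(j\omega)\right)^q\pi_\omega(i,k),$$ where $\hat R_\ell^{(i)}(j\omega)=\phi^{-1}(\hat P_\ell^{(i)}(j\omega))$ for $\ell=1,2$, and $\pi_\omega(i,k)$ denotes a valid joint distribution between the (projected) distributions at frequency $\omega$.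
   Context: $\Omega = [0,\infty)$ is the set of frequencies. The Riemann sphere is $\partial\mathfrak{R} = \{(x,y,z)\in\mathbb{R}^3 : x^2+y^2+(z-\tfrac12)^2=\tfrac14\}$. The inverse stereographic projection $\phi^{-1}:\mathbb{C}\to\partial\mathfrak{R}$ is $$\phi^{-1}(c) = \left(\frac{\mathrm{Re}(c)}{1+|c|^2},\frac{\mathrm{Im}(c)}{1+|c|^2},\frac{|c|^2}{1+|c|^2}\right),$$ and the chordal distance on $\partial\mathfrak{R}$ is $\mathrm{d_{chord}}(r_1,r_2)=\|r_1-r_2\|$ (Euclidean norm in $\mathbb{R}^3$). For a stochastic SISO system $P_\ell$ whose frequency response at $\omega$ has distribution $\mathbb{P}_{P_\ell(\omega)}$ on $\mathbb{C}$ with support $\mathcal{S}_{P_\ell}(\omega)$, put $\mathcal{R}_{P_\ell}(\omega)=\phi^{-1}(\mathcal{S}_{P_\ell}(\omega))$ and let $\mathbb{P}_{R_\ell(\omega)}$ be the push-forward of $\mathbb{P}_{P_\ell(\omega)}$ under $\phi^{-1}$. $\Pi_\omega=\Pi(\mathbb{P}_{R_1(\omega)},\mathbb{P}_{R_2(\omega)})$ is the set of all joint distributions with these marginals. The type-$q$ distance is $$\mathrm{d}_q(P_1,P_2) := \sup_{\omega\in\Omega}\ \inf_{\pi_\omega\in\Pi_\omega}\int_{\mathcal{R}_{P_1}(\omega)\times\mathcal{R}_{P_2}(\omega)}\mathrm{d_{chord}}(r_1,r_2)^q\,\pi_\omega(dr_1,dr_2)$$ (no $q$-th root is taken). In the empirical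 case a joint distribution is described by a nonnegative $N\times N$ array $\pi_\omega(i,k)$ over pairs of samples, all of whose row sums and column sums equal $1/N$. *)

(* Defs.v *)
From HB Require Import structures.
From mathcomp Require Import all_boot all_order all_algebra.
From mathcomp Require Import complex ring.
From mathcomp Require Import all_classical all_reals all_analysis.

Set Implicit Arguments.
Unset Strict Implicit.
Unset Printing Implicit Defensive.

Import Order.TTheory GRing.Theory Num.Theory.
Import Normc.
Import numFieldNormedType.Exports.

Local Open Scope classical_set_scope.
Local Open Scope ring_scope.
Local Open Scope complex_scope.

(* The topology of C is that of the modulus. *)
HB.instance Definition _ (R : realType) :=
  NormedModule.copy R[i] (R[i] : numClosedFieldType).

Definition frequencies (R : realType) : set R := `[0, +oo[%classic.
Arguments frequencies : clear implicits.

Definition borel (T : ptopologicalType) := g_sigma_algebraType (@open T).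
HB.instance Definition _ (T : ptopologicalType) := Measurable.on (borel T).

Definition measure_support (R : realType) (T : ptopologicalType)
    (mu : set (borel T) -> \bar R) : set T :=
  [set x | forall U : set T, open U -> U x -> (0 < mu U)%E].

Section Sphere.
Variable R : realType.

Definition sphere_set : set (R * R * R) :=
  [set r | r.1.1 ^+ 2 + r.1.2 ^+ 2 + (r.2 - 2^-1) ^+ 2 = 4^-1].

(* set_type carries the subspace topology of R^3. *)
Definition sphere : Type := set_type sphere_set.
HB.instance Definition _ := Choice.on sphere.
HB.instance Definition _ := Topological.on sphere.

Definition stereo_inv_pt (c : R[i]) : R * R * R :=
  (complex.Re c / (1 + normc c ^+ 2), complex.Im c / (1 + normc c ^+ 2),
   normc c ^+ 2 / (1 + normc c ^+ 2)).

Lemma stereo_inv_pt_sphere (c : R[i]) : stereo_inv_pt c \in sphere_set.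
Proof.
rewrite inE /sphere_set /stereo_inv_pt /=; case: c => a b /=.
rewrite sqr_sqrtr ?addr_ge0 ?sqr_ge0//.
have : 1 + (a ^+ 2 + b ^+ 2) != 0 by rewrite gt_eqF// ltr_wpDr// addr_ge0 ?sqr_ge0.
by move=> h; field.
Qed.

Definition stereo_inv (c : R[i]) : sphere :=
  exist _ (stereo_inv_pt c) (stereo_inv_pt_sphere c).

HB.instance Definition _ := isPointed.Build sphere (stereo_inv 0).

Definition chordal_dist (r1 r2 : sphere) : R :=
  let u := set_val r1 in let v := set_val r2 in
  Num.sqrt ((u.1.1 - v.1.1) ^+ 2 + (u.1.2 - v.1.2) ^+ 2 + (u.2 - v.2) ^+ 2).

End Sphere.

Arguments stereo_inv {R} c.

(* A stochastic system is given by the distribution on C of its frequency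
   response at each frequency w; the values at w < 0 are never used. *)
Definition stochastic_system (R : realType) :=
  R -> probability (borel R[i]) R.

Definition couplings (R : realType) (d : measure_display)
    (S : measurableType d) (mu1 mu2 : set S -> \bar R) :
    set (probability (S * S)%type R) :=
  [set pi | forall A : set S, measurable A ->
     pushforward pi fst A = mu1 A /\ pushforward pi snd A = mu2 A].

Section Distance.
Variable R : realType.
Implicit Types P : stochastic_system R.

Definition sphere_support P (w : R) : set (sphere R) :=
  stereo_inv @` measure_support (P w).

Definition sphere_law P (w : R) : set (borel (sphere R)) -> \bar R :=
  pushforward (P w)
    (stereo_inv : borel R[i] -> borel (sphere R)).

Definition type_q_distance (q : R) P1 P2 : \bar R :=
  ereal_sup [set ereal_inf
    [set (\int[pi]_(r in sphere_support P1 w `*` sphere_support P2 w)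
            (chordal_dist r.1 r.2 `^ q)%:E)%E
      | pi in couplings (sphere_law P1 w) (sphere_law P2 w)]
    | w in frequencies R].

End Distance.

Definition empirical_law (R : realType) (N : nat) (c : 'I_N -> R[i])
    (A : set (borel R[i])) : \bar R :=
  ((N%:R^-1 : R)%:E * \sum_(i < N) \d_(c i : borel R[i]) A)%E.

(* p i k is the mass given to the pair of samples (i, k); equal samples are
   kept as separate indices. *)
Definition empirical_couplings (R : realType) (N : nat) : set 'M[R]_N :=
  [set p | [/\ forall i k, 0 <= p i k,
     forall i, \sum_(k < N) p i k = N%:R^-1 &
     forall k, \sum_(i < N) p i k = N%:R^-1]].
Arguments empirical_couplings : clear implicits.

(* Main.v *)
Require Import Defs.
From mathcomp Require Import all_boot all_order all_algebra.
From mathcomp Require Import complex.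
From mathcomp Require Import all_classical all_reals all_analysis.
From mathcomp Require Import measurable_realfun.

Set Implicit Arguments.
Unset Strict Implicit.
Unset Printing Implicit Defensive.

Import Order.TTheory GRing.Theory Num.Theory.
Import Normc.
Import numFieldNormedType.Exports.

Local Open Scope classical_set_scope.
Local Open Scope ring_scope.
Local Open Scope complex_scope.

(** The identity holds frequency by frequency, and there the two sets of
    transport costs coincide, so that their infima do.

    Write [x i] and [y k] for the projected samples.  The support of an empirical
    law is the set of its samples, so the integral defining the distance runs
    over the finite set of the pairs [(x i, y k)]
    ([measure_support_empirical]), and an integral over a finite set is a sum
    over its points ([integral_range]).  The only difficulty is that samples
    may coincide: the matrices of the finite problem are indexed by samples,
    while a coupling only sees points.

    From a matrix [p] to a coupling: put the mass [p i k] at [(x i, y k)].  Masses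
    of coinciding pairs add up, which changes neither the marginals nor the
    cost ([integral_weighted_dirac_sum]).

    From a coupling to a matrix: share the mass of the point [(x i, y k)] equally
    among all pairs of indices that represent it, that is, divide it by the
    product of the multiplicities of [x i] and [y k].  The row sums are right
    because a coupling of empirical laws gives no mass to the points of the
    fibre over [x i] that lie over no [y k], and the fibre has the mass
    of [x i], which is its multiplicity over [N] ([coupling_fibre_mass]).  The
    cost is unchanged because summing the equal shares over a fibre restores
    the value ([average_over_fibre]).

    [empirical_coupling_costs] is this argument in an arbitrary measurable space
    whose points are measurable.  The sphere is one since its
    points are closed, and the law on it is the empirical law of the projected
    samples since the inverse stereographic projection is Borel, being
    continuous ([stereo_inv_continuous]). *)

(** * Topology and Borel sets of the plane and the sphere *)

Lemma continuous_le_modulus (R : realType) (f : {additive R[i] -> R}) :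
  (forall c, f c ^+ 2 <= complex.Re c ^+ 2 + complex.Im c ^+ 2) ->
  continuous (f : R[i] -> R).
Proof.
move=> fle z.
apply: (iffRL (@cvgrPdist_lt _ _ _ (nbhs z) (nbhs_filter z) _ _)) => e e0.
apply/nbhs_normP; exists e%:C; first by rewrite /= ltcR.
move=> t /=; rewrite normc_def ltcR -raddfB; apply: le_lt_trans.
by rewrite -sqrtr_sqr ler_wsqrtr// raddfB fle.
Qed.

Lemma Re_continuous (R : realType) : continuous (@complex.Re R : R[i] -> R).
Proof. by apply: continuous_le_modulus => c; rewrite lerDl sqr_ge0. Qed.

Lemma Im_continuous (R : realType) : continuous (@complex.Im R : R[i] -> R).
Proof. by apply: continuous_le_modulus => c; rewrite lerDr sqr_ge0. Qed.

Lemma sqr_normc (R : realType) (c : R[i]) :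
  normc c ^+ 2 = complex.Re c * complex.Re c + complex.Im c * complex.Im c.
Proof. by case: c => a b /=; rewrite sqr_sqrtr ?addr_ge0 ?sqr_ge0// !expr2. Qed.

(** The sphere has the topology induced by its inclusion in the space of
    triples, so continuity is checked on the three coordinates. *)
Lemma stereo_inv_continuous (R : realType) : continuous (@stereo_inv R).
Proof.
apply: continuous_comp_initial => c.
have FF : ProperFilter (nbhs c) := nbhs_pfilter c.
have nc : (fun c : R[i] => normc c ^+ 2) @ c --> normc c ^+ 2.
  under eq_fun do rewrite sqr_normc.
  rewrite sqr_normc.
  by apply: cvgD; apply: cvgM; exact: Re_continuous || exact: Im_continuous.
have cd : (fun c : R[i] => (1 + normc c ^+ 2)^-1) @ c -->
          (1 + normc c ^+ 2)^-1.
  apply: cvgV; last by apply: cvgD => //; exact: cvg_cst.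
  by rewrite gt_eqF// ltr_wpDr// sqr_ge0.
have mul (f : R[i] -> R) : f @ c --> f c ->
    f x / (1 + normc x ^+ 2) @[x --> c] --> f c / (1 + normc c ^+ 2).
  by move=> fc; exact: cvgM.
have := cvg_pair (cvg_pair (mul _ (@Re_continuous R c))
  (mul _ (@Im_continuous R c))) (mul _ nc).
exact.
Qed.

Lemma finite_closed_sphere (R : realType) (A : set (sphere R)) :
  finite_set A -> closed A.
Proof.
move=> finA.
have cA : closed (set_val @` A : set (R * R * R)).
  apply: (iffLR accessible_finite_set_closed); last exact: finite_image.
  exact/hausdorff_accessible/norm_hausdorff.
have -> : A = set_val @^-1` (set_val @` A : set (R * R * R)).
  by apply/seteqP; split=> [x Ax|x [y Ay] /val_inj <-//]; exists x.
by apply: (closed_comp _ cA) => x _; exact: initial_continuous.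
Qed.

Lemma closed_borel (T : ptopologicalType) (A : set (borel T)) :
  closed (A : set T) -> measurable A.
Proof.
move=> cA; rewrite -[A]setCK; apply: measurableC.
by apply: sub_sigma_algebra; exact: closed_openC.
Qed.

Lemma continuous_borel (T U : ptopologicalType) (f : T -> U)
    (A : set (borel U)) :
  continuous f -> measurable A -> measurable (f @^-1` A : set (borel T)).
Proof.
move=> cf mA; rewrite -[_ @^-1` _]setTI.
apply: (@measurability _ _ (borel T) (borel U) setT f (@open U)) => //.
move=> _ [B oB <-]; rewrite setTI; apply: sub_sigma_algebra.
by apply: open_comp => // x _; exact: cf.
Qed.

(** * Finite families of points with repetitions *)

Definition multiplicity (I : finType) (T : eqType) (g : I -> T) (x : T) : nat :=
  #|[pred i | g i == x]|.

Lemma multiplicity_gt0 (I : finType) (T : eqType) (g : I -> T) (i : I) :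
  (0 < multiplicity g (g i))%N.
Proof. by apply/card_gt0P; exists i; rewrite inE. Qed.

(** All terms are equal, and the multiplicity is their number. *)
Lemma average_over_fibre (R : realType) (I : finType) (T : eqType)
    (g : I -> T) (a : T -> R) i :
  \sum_(j | g j == g i) a (g j) / (multiplicity g (g j))%:R = a (g i).
Proof.
under eq_bigr => j /eqP -> do [].
rewrite sumr_const -[LHS]mulr_natr divfK// pnatr_eq0 -lt0n.
exact: multiplicity_gt0.
Qed.

(** * Integrals over finite sets *)

Lemma measurable_range d (T : measurableType d) (I : finType) (g : I -> T) :
  (forall i, measurable [set g i]) -> measurable (range g).
Proof.
by move=> mg; rewrite -bigcup_imset1; exact: fin_bigcup_measurable.
Qed.

(** On the range of [g], the function [f] is the combination of the indicators of
    the points [g i] with coefficients [f (g i)] over the multiplicity: it is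
    simple there, and the integral is linear. *)
Lemma integral_range (R : realType) d (T : measurableType d)
    (mu : measure T R) (I : finType) (g : I -> T) (f : T -> R) :
  (forall i, measurable [set g i]) -> (forall x, 0 <= f x) ->
  (\int[mu]_(x in range g) (f x)%:E =
   \sum_i (f (g i) / (multiplicity g (g i))%:R)%:E * mu [set g i])%E.
Proof.
move=> mg f0.
have mD := measurable_range mg.
pose c i : R := f (g i) / (multiplicity g (g i))%:R.
have c0 i : 0 <= c i by rewrite divr_ge0.
have mc i : measurable_fun (range g) (fun x => (c i * \1_[set g i] x)%:E).
  by apply/measurable_EFinP; exact: measurable_funM.
have fE x : range g x -> (f x)%:E = (\sum_i (c i * \1_[set g i] x)%:E)%E.
  move=> [j _ <-]; rewrite sumEFin -(average_over_fibre g f j) big_mkcond.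
  congr (_%:E); apply: eq_bigr => i _; rewrite indicE.
  case: eqP => [ij|ij]; first by rewrite mem_set ?mulr1// /set1/= ij.
  by rewrite memNset ?mulr0//= => /esym.
under eq_integral => x /set_mem/fE -> do [].
rewrite ge0_integral_sum//; last first.
  by move=> j x _; rewrite lee_fin mulr_ge0.
apply: eq_bigr => i _; under eq_integral do rewrite EFinM.
rewrite ge0_integralZl//; last by rewrite lee_fin.
  by rewrite integral_indic// (setIidl _)// => x ->; exists i.
exact/measurable_EFinP.
Qed.

Lemma exists_weighted_dirac_sum (R : realType) d (T : measurableType d)
    (I : Type) (w : I -> R) (g : I -> T) (s : seq I) : (forall i, 0 <= w i) ->
  exists mu : measure T R,
    forall A, mu A = (\sum_(i <- s) (w i)%:E * \d_(g i) A)%E.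
Proof.
move=> w0; elim: s => [|i s [mu muE]].
  by exists mzero => A; rewrite big_nil.
exists (measure_add (mscale (NngNum (w0 i)) (dirac (g i))) mu) => A.
by rewrite big_cons -muE; exact: measure_addE.
Qed.

Lemma exists_probability (R : realType) d (T : measurableType d)
    (mu : measure T R) :
  mu setT = 1%E -> exists P : probability T R, forall A, P A = mu A.
Proof.
(* Normalization divides by the total mass 1; [point] is its default value for
   a total mass of zero or infinity. *)
move=> mu1; exists (mnormalize mu point) => A.
by rewrite /= /mnormalize mu1 onee_eq0/= invr1 mule1.
Qed.

(** The mass of a point [g i] is the sum of the weights of its fibre; exchanging
    the two sums makes the equal shares of [integral_range] add up again. *)
Lemma integral_weighted_dirac_sum (R : realType) d (T : measurableType d)
    (mu : measure T R) (I : finType) (w : I -> R) (g : I -> T) (f : T -> R) :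
  (forall i, measurable [set g i]) -> (forall x, 0 <= f x) ->
  (forall A, mu A = (\sum_i (w i)%:E * \d_(g i) A)%E) ->
  (\int[mu]_(x in range g) (f x)%:E = (\sum_i f (g i) * w i)%:E)%E.
Proof.
move=> mg f0 muE; rewrite integral_range//.
have mu1 i : mu [set g i] = (\sum_j w j * (g i == g j)%:R)%:E.
  rewrite muE -sumEFin; apply: eq_bigr => j _; rewrite diracE -EFinM.
  case: eqP => [->|ij]; first by rewrite mem_set.
  by rewrite memNset//= => /esym.
under eq_bigr do rewrite mu1 -EFinM mulr_sumr.
rewrite sumEFin exchange_big/=; congr (_%:E); apply: eq_bigr => j _.
rewrite -(average_over_fibre g f j) mulr_suml [RHS]big_mkcond/=.
by apply: eq_bigr => i _; case: eqP => _; rewrite ?mulr1 ?mulr0 ?mul0r.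
Qed.

Lemma measure_sum_atoms (R : realType) d (T : measurableType d)
    (mu : measure T R) (I : finType) (g : I -> T) (A : set T) :
  (forall i, measurable [set g i]) -> measurable A -> range g `<=` A ->
  mu (A `\` range g) = 0%E ->
  mu A = (\sum_i ((multiplicity g (g i))%:R^-1)%:E * mu [set g i])%E.
Proof.
move=> mg mA gA mu0.
have mD := measurable_range mg.
have -> : mu A = mu (range g).
  rewrite -[in LHS](setDUK gA) measureU//;
    [|exact: measurableD|exact: setDIK].
  by rewrite [X in (_ + X)%E]mu0 adde0.
(* The measure of the range is the integral of 1 over it. *)
rewrite -[LHS]mul1e -integral_cst// (@integral_range _ _ _ mu _ g (cst 1))//=.
by under eq_bigr do rewrite div1r.
Qed.

(** * Couplings of empirical laws *)

Definition sample_fraction (R : realType) N (T : Type) (x : 'I_N -> T)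
    (A : set T) : R :=
  \sum_(i < N) N%:R^-1 * (x i \in A)%:R.
Arguments sample_fraction R {N T} x A.

Lemma sample_fraction1 (R : realType) N (T : eqType) (x : 'I_N -> T) (s : T) :
  sample_fraction R x [set s] = (multiplicity x s)%:R / N%:R.
Proof.
rewrite /sample_fraction -mulr_sumr mulrC; congr (_ * _).
rewrite /multiplicity -sum1_card natr_sum [RHS]big_mkcond/=.
apply: eq_bigr => i _; rewrite inE/=; case: eqP => [->|xs].
  by rewrite mem_set.
by rewrite memNset.
Qed.

Lemma sample_fractionC_range (R : realType) N (T : Type) (x : 'I_N -> T) :
  sample_fraction R x (~` range x) = 0.
Proof.
rewrite /sample_fraction big1// => i _.
by rewrite memNset ?mulr0//=; apply; exists i.
Qed.

(** The fibre of [h] over [s] has the mass that the first sample gives to [s], and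
    it is carried by the points [g k], since [h'] almost surely takes its values
    among the [y k].  With [h] and [h'] the two projections, in either order, this
    gives the row sums and the column sums. *)
Lemma coupling_fibre_mass (R : realType) d (S : measurableType d)
    d' (T : measurableType d') N (pi : probability T R) (h h' : T -> S)
    (x y : 'I_N -> S) (g : 'I_N -> T) (s : S) :
  measurable_fun setT h -> measurable_fun setT h' ->
  (forall s : S, measurable [set s]) ->
  (forall A, measurable A -> pi (h @^-1` A) = (sample_fraction R x A)%:E) ->
  (forall A, measurable A -> pi (h' @^-1` A) = (sample_fraction R y A)%:E) ->
  (forall k t, t = g k <-> h t = s /\ h' t = y k) ->
  \sum_(k < N) fine (pi [set g k]) / (multiplicity y (y k))%:R =
  (multiplicity x s)%:R / N%:R.
Proof.
move=> mh mh' m1 hpi h'pi gP.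
have mpre (u : T -> S) A :
    measurable_fun setT u -> measurable A -> measurable (u @^-1` A).
  by move=> mu mA; rewrite -[_ @^-1` _]setTI; exact: mu.
have mg k : measurable [set g k].
  rewrite (_ : [set g k] = h @^-1` [set s] `&` h' @^-1` [set y k]).
    by apply: measurableI; exact: mpre.
  by apply/seteqP; split=> t /=; [move/gP|move=> ?; apply/gP].
have my : measurable (range y) by exact: measurable_range.
have multg k : multiplicity g (g k) = multiplicity y (y k).
  apply: eq_card => j; rewrite !inE; apply/eqP/eqP => [/gP[]|yjk].
    by have /gP[_ <-] := erefl (g j).
  by apply/gP; rewrite -yjk; apply/gP.
apply: EFin_inj; rewrite -sample_fraction1 -hpi//.
rewrite (@measure_sum_atoms _ _ _ _ _ g)//.
- rewrite -sumEFin; apply: eq_bigr => k _.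
  by rewrite multg mulrC EFinM fineK// fin_num_measure.
- exact: mpre.
- by move=> _ [k _ <-]; have /gP[] := erefl (g k).
- apply: (@subset_measure0 _ _ _ pi _ (h' @^-1` (~` range y))).
  + by apply: measurableD; [exact: mpre|exact: measurable_range].
  + by apply: mpre => //; exact: measurableC.
  + by move=> t [/= hs ngt] [k _ yk]; apply: ngt; exists k => //; apply/esym/gP.
  + by have := h'pi _ (measurableC my); rewrite sample_fractionC_range.
Qed.

(** Equal shares turn a coupling into a matrix, and point masses turn a matrix
    into a coupling; neither passage changes the cost, and no optimal coupling
    is involved. *)
Lemma empirical_coupling_costs (R : realType) d (S : measurableType d) N
    (x y : 'I_N -> S) (mu1 mu2 : set S -> \bar R) (f : S * S -> R) :
  (0 < N)%N ->
  (forall s : S, measurable [set s]) ->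
  (forall A, measurable A -> mu1 A = (sample_fraction R x A)%:E) ->
  (forall A, measurable A -> mu2 A = (sample_fraction R y A)%:E) ->
  (forall r, 0 <= f r) ->
  [set (\int[pi]_(r in range x `*` range y) (f r)%:E)%E
    | pi in couplings mu1 mu2] =
  [set (\sum_(i < N) \sum_(k < N) f (x i, y k) * p i k)%:E
    | p in empirical_couplings R N].
Proof.
move=> N0 m1 mu1E mu2E f0.
pose g (u : 'I_N * 'I_N) := (x u.1, y u.2).
have gE : range x `*` range y = range g.
  apply/seteqP; split=> [[a b] [/= [i _ <-] [k _ <-]]|_ [[i k] _ <-]].
    by exists (i, k).
  by split; [exists i|exists k].
have mg u : measurable [set g u].
  rewrite (_ : [set g u] = [set x u.1] `*` [set y u.2]).
    exact: measurableX.
  by apply/seteqP; split=> [_ ->//|[a b] [] /= -> ->].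
rewrite gE; apply/seteqP; split=> [_ [pi pi12 <-]|_ [p [p0 prow pcol] <-]].
- (* A coupling yields a matrix: pairs of indices with the same pair of samples
     get equal shares of its mass. *)
  pose p : 'M[R]_N := \matrix_(i, k) (fine (pi [set (x i, y k)]) /
    (multiplicity x (x i) * multiplicity y (y k))%:R).
  have pi1 A : measurable A -> pi (fst @^-1` A) = (sample_fraction R x A)%:E.
    by move=> mA; rewrite -mu1E//; have [] := pi12 A mA.
  have pi2 A : measurable A -> pi (snd @^-1` A) = (sample_fraction R y A)%:E.
    by move=> mA; rewrite -mu2E//; have [] := pi12 A mA.
  have mult_neq0 (z : 'I_N -> S) i : (multiplicity z (z i))%:R != 0 :> R.
    by rewrite pnatr_eq0 -lt0n multiplicity_gt0.
  exists p.
    split=> [i k|i|k].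
    + by rewrite mxE divr_ge0// fine_ge0.
    + under eq_bigr do rewrite mxE natrM invfM mulrCA.
      rewrite -mulr_sumr (coupling_fibre_mass (g := fun k => (x i, y k))
        measurable_fst measurable_snd m1 pi1 pi2 (s := x i)).
        by rewrite mulKf.
      by move=> k [a b]/=; split=> [[-> ->]|[-> ->]].
    + under eq_bigr do rewrite mxE mulnC natrM invfM mulrCA.
      rewrite -mulr_sumr (coupling_fibre_mass (g := fun i => (x i, y k))
        measurable_snd measurable_fst m1 pi2 pi1 (s := y k)).
        by rewrite mulKf.
      by move=> i [a b]/=; split=> [[-> ->]|[-> ->]].
  have multg i k : multiplicity g (x i, y k) =
                   (multiplicity x (x i) * multiplicity y (y k))%N.
    rewrite /multiplicity -cardX; apply: eq_card => -[a b].
    by rewrite !inE xpair_eqE.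
  rewrite integral_range// (pair_big predT predT)/= -sumEFin.
  apply: eq_bigr => -[i k] _ /=.
  rewrite multg mxE -[X in (_ * X)%E]fineK ?fin_num_measure// -EFinM.
  by rewrite mulrAC -mulrA.
- (* A matrix yields a coupling: its entries are the weights of point masses at
     the pairs of samples. *)
  pose w u := p u.1 u.2.
  have w0 u : 0 <= w u := p0 u.1 u.2.
  have [mu muE] := exists_weighted_dirac_sum g (enum {: 'I_N * 'I_N}) w0.
  have {}muE A : mu A = (\sum_u (w u)%:E * \d_(g u) A)%E.
    by rewrite muE big_enum.
  have muER A : mu A = (\sum_i \sum_k p i k * (g (i, k) \in A)%:R)%:E.
    rewrite muE (pair_big predT predT)/= -sumEFin.
    by apply: eq_bigr => -[i k] _; rewrite diracE EFinM.
  have mu_fst A : mu (fst @^-1` A) = (sample_fraction R x A)%:E.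
    rewrite muER; congr (_%:E); apply: eq_bigr => i _.
    by rewrite -(prow i) mulr_suml; apply: eq_bigr => k _.
  have mu_snd A : mu (snd @^-1` A) = (sample_fraction R y A)%:E.
    rewrite muER exchange_big; congr (_%:E); apply: eq_bigr => k _.
    by rewrite -(pcol k) mulr_suml; apply: eq_bigr => i _.
  have [|pi piE] := exists_probability (mu := mu).
    rewrite -(preimage_setT fst) mu_fst /sample_fraction.
    under eq_bigr do rewrite in_setT mulr1.
    rewrite sumr_const card_ord -[X in X%:E]mulr_natl divff//.
    by rewrite pnatr_eq0 -lt0n.
  exists pi.
    by move=> A mA; rewrite /pushforward !piE mu_fst mu_snd mu1E// mu2E.
  rewrite (integral_weighted_dirac_sum (w := w))//.
    by rewrite (pair_big predT predT).
  by move=> A; rewrite -muE; exact: piE.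
Qed.

(** * Empirical laws on the plane *)

Lemma empirical_lawE (R : realType) N (c : 'I_N -> R[i])
    (A : set (borel R[i])) :
  empirical_law c A = (sample_fraction R c A)%:E.
Proof.
rewrite /empirical_law /sample_fraction -mulr_sumr EFinM -sumEFin.
by under eq_bigr do rewrite diracE.
Qed.

(** A neighbourhood of a sample has mass at least [1 / N], and the complement of
    the finite set of samples is an open null set. *)
Lemma measure_support_empirical (R : realType) N (c : 'I_N -> R[i])
    (P : set (borel R[i]) -> \bar R) :
  (0 < N)%N ->
  (forall A, measurable A -> P A = empirical_law c A) ->
  measure_support P = range c.
Proof.
move=> N0 PE.
have {}PE (U : set R[i]) : open U -> P U = (sample_fraction R c U)%:E.
  by move=> oU; rewrite PE ?empirical_lawE//; exact: sub_sigma_algebra.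
apply/seteqP; split=> [z zP|_ [i _ <-] U oU Uci].
- apply: contrapT => nz.
  have oC : open (~` range c).
    apply: closed_openC; apply: (iffLR accessible_finite_set_closed).
      exact/hausdorff_accessible/(@norm_hausdorff R[i] R[i]).
    exact/finite_image/finite_finset.
  by have := zP _ oC nz; rewrite PE// sample_fractionC_range ltxx.
- rewrite PE// lte_fin /sample_fraction (bigD1 i)//= mem_set// mulr1.
  rewrite ltr_pwDl ?invr_gt0 ?ltr0n//.
  by apply: sumr_ge0 => j _; rewrite mulr_ge0.
Qed.

Theorem mainTheorem3 (R : realType) (q : R) (hq : 1 <= q)
    (N : nat) (hN : (0 < N)%N)
    (P1 P2 : stochastic_system R)
    (Phat1 Phat2 : 'I_N -> R -> R[i])
    (hP1 : forall w, frequencies R w -> forall A : set (borel R[i]),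
       measurable A -> P1 w A = empirical_law (Phat1 ^~ w) A)
    (hP2 : forall w, frequencies R w -> forall A : set (borel R[i]),
       measurable A -> P2 w A = empirical_law (Phat2 ^~ w) A) :
  type_q_distance q P1 P2 =
  ereal_sup [set ereal_inf
    [set (\sum_(i < N) \sum_(k < N)
            chordal_dist (stereo_inv (Phat1 i w)) (stereo_inv (Phat2 k w)) `^ q
              * p i k)%:E
      | p in empirical_couplings R N]
    | w in frequencies R].
Proof.
congr ereal_sup; apply: eq_imagel => w ww; congr ereal_inf.
have law (P : stochastic_system R) (c : 'I_N -> R -> R[i]) :
    (forall A, measurable A -> P w A = empirical_law (c ^~ w) A) ->
    sphere_support P w = range (fun i => stereo_inv (c i w)) /\
    forall A, measurable A ->
      sphere_law P w A = (sample_fraction R (fun i => stereo_inv (c i w)) A)%:E.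
  move=> PE; split=> [|A mA].
    by rewrite /sphere_support (measure_support_empirical hN PE) image_comp.
  rewrite /sphere_law /pushforward PE ?empirical_lawE//.
  exact: continuous_borel (@stereo_inv_continuous R) mA.
have [-> law1] := law _ _ (hP1 w ww).
have [-> law2] := law _ _ (hP2 w ww).
apply: (@empirical_coupling_costs R _ (borel (sphere R)) N _ _ _ _
  (fun r => chordal_dist r.1 r.2 `^ q) hN _ law1 law2).
  by move=> s; apply: closed_borel; exact: finite_closed_sphere.
by move=> r; exact: powR_ge0.
Qed.
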